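(* Let $I=(A,\succ,c)$ be an SF instance, let $\Pi$ be a GSP of $I$, and let $\Pi_i=(a_{i_1}\ a_{i_2}\ \dots\ a_{i_k})\in\Pi$ be a cycle of even length $k$. Then $\Pi'=(\Pi\setminus\{\Pi_i\})\cup\{(a_{i_1}\ a_{i_2}),(a_{i_3}\ a_{i_4}),\dots,(a_{i_{k-1}}\ a_{i_k})\}$ and $\Pi''=(\Pi\setminus\{\Pi_i\})\cup\{(a_{i_1}\ a_{i_k}),(a_{i_2}\ a_{i_3}),\dots,(a_{i_{k-2}}\ a_{i_{k-1}})\}$ are both GSPs of $I$.
   Context: A Stable Fixtures (SF) instance is $I=(A,\succ,c)$ where $A=\{a_1,\dots,a_n\}$ is a finite set of $n$ agents; each agent $a_i$ has a strict linear order $\succ_i$ over $A\setminus\{a_i\}$ (complete preference list), with the convention that every agent ranks itself last ($a_j\succ_i a_i$ for all $j\neq i$); $a\succeq_i b$ means $a\succ_i b$ or $a=b$. Each agent has an integer capacity $c_i$ with $1\le c_i<n$. A cyclic permutation of a nonempty set $A_r\subseteq A$ is a permutation $\Pi_r$ of $A_r$ consisting of a single cycle of length $|A_r|$ (length 1: a fixed point $(a_i)$; length 2: a transposition $(a_i\ a_j)$). Two cyclic permutations are distinct if some element is mapped to different elements by them. A GSP (generalised stable partition) of $I$ is a finite collection $\Pi=\{\Pi_1,\dots,\Pi_k\}$ of cyclic permutations $\Pi_r$ of sets $A_r\subseteq A$, pairwise distinct except that fixed points may be repeated, such that: (F1) for every $r$ and every $a_j\in A_r$, $\Pi_r(a_j)\succeq_j\Pi_r^{-1}(a_j)$;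 (F2) there are no distinct $a_i,a_j\in A$ with the transposition $(a_i\ a_j)\notin\Pi$ such that $a_j\succ_i\Pi_r^{-1}(a_i)$ and $a_i\succ_j\Pi_s^{-1}(a_j)$ for some $\Pi_r,\Pi_s\in\Pi$ with $a_i\in A_r$, $a_j\in A_s$; (F3) for every $a_i\in A$, the number of indices $r$ with $a_i\in A_r$ equals $c_i$; (F4) for all distinct $a_i,a_j\in A$, $|\{s:\Pi_s(a_i)=a_j\}|+|\{s:\Pi_s(a_j)=a_i\}|\le 2$. *)

(* Defs.v *)
From mathcomp Require Import all_boot all_fingroup.

Set Implicit Arguments.
Unset Strict Implicit.
Unset Printing Implicit Defensive.

(* [pref i a b] means that [i] strictly prefers [a] to [b].  The strict order
   on the other agents is extended to all of [A] by the convention that every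
   agent ranks itself last. *)
Record sf_instance (A : finType) := SFInstance {
  pref : A -> rel A;
  cap : A -> nat;
  pref_irr : forall i, irreflexive (pref i);
  pref_trans : forall i, transitive (pref i);
  pref_total : forall i a b, a != b -> pref i a b || pref i b a;
  pref_self_last : forall i j, j != i -> pref i j i;
  cap_bounds : forall i, 1 <= cap i < #|A|
}.

Definition weak_pref (A : finType) (I : sf_instance A) (i : A) : rel A :=
  fun a b => pref I i a b || (a == b).

(* A permutation of a subset S of A is encoded as the pair (S, s) where s is
   its extension to A by the identity.  Keeping S is essential: the fixed
   points (a), for a in A, all have s = 1. *)
Definition subperm (A : finType) : Type := ({set A} * {perm A})%type.

Definition cyclic_perm (A : finType) (C : subperm A) : Prop :=
  [/\ C.1 != set0, perm_on C.1 C.2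
    & forall x, x \in C.1 -> porbit C.2 x = C.1].

Definition transposition (A : finType) (x y : A) : subperm A :=
  ([set x; y], tperm x y).

(* C is the cycle (a_1 a_2 ... a_k) where s = [:: a_1; ...; a_k]; [next] wraps
   around. *)
Definition cycle_notation (A : finType) (C : subperm A) (s : seq A) : Prop :=
  [/\ uniq s, C.1 = [set x in s] & forall x, x \in s -> C.2 x = next s x].

(* Collections are finite families, hence sequences with multiplicity.  Since
   cycles of length at least 2 move some element, two of them are equal as
   pairs exactly when they map every element of A to the same element. *)
Record gsp (A : finType) (I : sf_instance A) (Pi : seq (subperm A)) : Prop :=
  GSP {
  gsp_cyclic : forall C, C \in Pi -> cyclic_perm C;
  gsp_distinct : uniq [seq C : subperm A <- Pi | #|C.1| != 1];
  gsp_F1 : forall C x, C \in Pi -> x \in C.1 ->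
    weak_pref I x (C.2 x) ((C.2)^-1%g x);
  gsp_F2 : ~ exists x y : A,
    [/\ x != y, transposition x y \notin Pi
      & exists C D : subperm A,
        [/\ C \in Pi /\ x \in C.1, D \in Pi /\ y \in D.1,
            pref I x y ((C.2)^-1%g x) & pref I y x ((D.2)^-1%g y)]];
  gsp_F3 : forall x, count (fun C : subperm A => x \in C.1) Pi = cap I x;
  gsp_F4 : forall x y, x != y ->
    count (fun C : subperm A => (x \in C.1) && (C.2 x == y)) Pi +
    count (fun C : subperm A => (y \in C.1) && (C.2 y == x)) Pi <= 2
}.

(* (a_1 a_2), (a_3 a_4), ..., (a_{k-1} a_k) for s = [:: a_1; ...; a_k]. *)
Fixpoint paired (A : finType) (s : seq A) : seq (subperm A) :=
  if s is x :: y :: s' then transposition x y :: paired s' else [::].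

(* Main.v *)
(* The delicate condition is (F4): if a_1 a_2 are consecutive in the split cycle,
   no other cycle may use an arc between them.  This holds because cycles of
   length at least 3 of a GSP are pairwise disjoint.  Suppose that z lies on two
   of them, with predecessors u and v, and prefers u to v.  Then u, whose
   successor z is better than its predecessor by (F1), blocks with z, and (F4)
   keeps the transposition (u z) out of the GSP, contradicting (F2).  So u = v,
   and following predecessors the two cycles coincide.  For (F2), each agent of
   a new transposition gets its former successor or predecessor as partner, hence
   nothing worse than its former predecessor. *)
Require Import Defs.
From mathcomp Require Import all_boot all_fingroup.

Set Implicit Arguments.
Unset Strict Implicit.
Unset Printing Implicit Defensive.

(** * Transpositions, cycles and the pairing of a sequence *)

Section Transpositions.
Variable A : finType.
Implicit Types (x y z u v : A) (C D T : subperm A) (s : seq A).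

(** Follows the recursion of [paired], which consumes two entries at a time. *)
Lemma pair_seq_ind (P : seq A -> Prop) :
  P [::] -> (forall x, P [:: x]) ->
  (forall x y s, P s -> P [:: x, y & s]) -> forall s, P s.
Proof.
move=> P0 P1 P2; fix IH 1 => -[|x [|y s]]; [exact: P0 | exact: P1 |].
by apply: P2; apply: IH.
Qed.

Lemma transpositionC x y : transposition x y = transposition y x.
Proof. by rewrite /transposition setUC tpermC. Qed.

Lemma tperm_arc x y u v :
  x \in [set u; v] -> tperm u v x = y -> transposition u v = transposition x y.
Proof.
by rewrite !inE => /orP[] /eqP ->; rewrite (tpermL, tpermR) => <- //;
   rewrite transpositionC.
Qed.

Lemma transposition_eq x y u v :
  x != y -> transposition x y = transposition u v ->
  (x = u /\ y = v) \/ (x = v /\ y = u).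
Proof.
move=> xy E; have := congr1 (fun T => (x \in T.1) && (y \in T.1)) E.
rewrite /= !inE !eqxx orbT /= => /esym/andP[].
by case/orP=> /eqP xE /orP[] /eqP yE; move: xy; rewrite xE yE ?eqxx; auto.
Qed.

Lemma porbit_invol (p : {perm A}) x : p (p x) = x -> porbit p x = [set x; p x].
Proof.
move=> ppx; apply/setP => z; apply/porbitP/set2P => [[i ->] {z}|].
  elim: i => [|i IH]; first by rewrite expg0 perm1; left.
  by rewrite expgSr permM; case: IH => ->; rewrite ?ppx; auto.
by case=> ->; [exists 0; rewrite expg0 perm1 | exists 1; rewrite expg1].
Qed.

Lemma cyclic_transposition x y : cyclic_perm (transposition x y).
Proof.
split=> /= [||z].
- by apply/set0Pn; exists x; rewrite set21.
- exact: tperm_on.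
- rewrite porbit_invol ?tpermK // => /set2P[] ->; rewrite ?tpermL ?tpermR //.
  exact: setUC.
Qed.

Lemma cyclic_image C x : cyclic_perm C -> x \in C.1 -> C.2 x \in C.1.
Proof. by case=> _ /perm_closed ->. Qed.

Lemma cyclic_preim C x : cyclic_perm C -> x \in C.1 -> (C.2)^-1%g x \in C.1.
Proof. by case=> _ /perm_onV/perm_closed ->. Qed.

Lemma two_cycle C x y :
  cyclic_perm C -> x \in C.1 -> C.2 x = y -> C.2 y = x -> C = transposition x y.
Proof.
case: C => S p [/= _ pS orbS] xS px py.
have S_E : S = [set x; y] by rewrite -(orbS x xS) porbit_invol px // py.
congr pair => //; apply/permP => z; case: tpermP => [->|->|/eqP zx /eqP zy] //.
by apply: (out_perm pS); rewrite S_E !inE negb_or zx.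
Qed.

Lemma long_cycle_arc C x :
  cyclic_perm C -> 2 < #|C.1| -> x \in C.1 -> C.2 (C.2 x) != x.
Proof.
move=> Cc lC xC; apply: contraL lC => /eqP CCx.
by rewrite -leqNgt (two_cycle Cc xC erefl CCx) cards2; case: (_ != _).
Qed.

Lemma arc_long_cycle C x :
  cyclic_perm C -> x \in C.1 -> C.2 x != x -> C.2 (C.2 x) != x -> 2 < #|C.1|.
Proof.
move=> Cc xC Cx CCx; apply/card_gt2P; exists x, (C.2 x), (C.2 (C.2 x)).
by split; split; rewrite ?cyclic_image // 1?eq_sym // (inj_eq perm_inj).
Qed.

Lemma mem_paired (f : A -> A) s T :
  sorted (frel f) s -> T \in paired s ->
  exists2 x, x \in s & T = transposition x (f x).
Proof.
elim/pair_seq_ind: s => // x y s IH /= /andP[/eqP fx /path_sorted/IH{}IH].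
rewrite inE => /orP[/eqP-> | /IH[z zs ->]].
  by exists x; rewrite ?mem_head ?fx.
by exists z; rewrite // !inE zs !orbT.
Qed.

(** Gives (F3) for the new collection, the distinctness of its pairs, and the bound on their arcs in
    (F4). *)
Lemma count_paired s x :
  uniq s -> ~~ odd (size s) ->
  count (fun T => x \in T.1) (paired s) = (x \in s).
Proof.
elim/pair_seq_ind: s => //= a b s IH /and3P[].
rewrite negbK !inE negb_or => /andP[ab as_] bs /IH{}IH /IH->.
case: (eqVneq x a) => [->|_] /=; first by rewrite (negbTE as_).
by case: (eqVneq x b) => [->|_] //=; rewrite (negbTE bs).
Qed.

Lemma paired_uniq s : uniq s -> ~~ odd (size s) -> uniq (paired s).
Proof.
elim/pair_seq_ind: s => //= a b s IH /and3P[].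
rewrite negbK inE negb_or => /andP[_ as_] _ us ev; rewrite IH // andbT.
(* If this pair recurred later, the later copy would cover [a], forcing [a] to occur in [s]. *)
apply: contra as_ => ab; rewrite -[a \in s]lt0b -count_paired // -has_count.
by apply/hasP; exists (transposition a b); rewrite //= set21.
Qed.

(** Reduces the second pairing of the cycle to the first. *)
Lemma cycle_notation_rotr C s :
  cycle_notation C s -> cycle_notation C (rotr 1 s).
Proof.
case=> us Cs Cnext; split; rewrite ?rotr_uniq //.
  by rewrite Cs; apply/setP => x; rewrite !inE mem_rotr.
by move=> x; rewrite mem_rotr next_rotr //; apply: Cnext.
Qed.

Lemma mem_paired_cycle C s T :
  cycle_notation C s -> T \in paired s ->
  exists2 x, x \in C.1 & T = transposition x (C.2 x).
Proof.
(* Opening the cycle of [next s] drops only its closing arc. *)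
case=> us Cs Cnext Ts; have next_sorted : sorted (frel (next s)) s.
  case: s us {Cs Cnext Ts} => // a s us.
  by have := cycle_next us; rewrite /= rcons_path => /andP[].
have [x xs ->] := mem_paired next_sorted Ts.
by exists x; rewrite ?Cnext // Cs inE.
Qed.

End Transpositions.

(** * Long cycles of a GSP and their splitting *)

Section GSP.
Variables (A : finType) (I : sf_instance A).
Implicit Types (x y z u : A) (C D T : subperm A) (Pi : seq (subperm A)).

(** Serves for cycles of length 2, where splitting only moves the cycle to the end of the list. *)
Lemma gsp_perm Pi Pi' : perm_eq Pi Pi' -> gsp I Pi -> gsp I Pi'.
Proof.
move=> e [G1 G2 G3 G4 G5 G6]; have mE := perm_mem e; have cE := seq.permP e.
split.
- by move=> C; rewrite -mE; apply: G1.
- by rewrite -(perm_uniq (perm_filter _ e)).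
- by move=> C x; rewrite -mE; apply: G3.
- case=> x [y [xy nT [C [D [[CP xC] [DP yD] p q]]]]]; apply: G4.
  by exists x, y; rewrite mE; split=> //; exists C, D; rewrite !mE.
- by move=> x; rewrite -cE.
- by move=> x y xy; rewrite -!cE; apply: G6.
Qed.

Lemma weak_pref_trans i a b c :
  pref I i a b -> weak_pref I i b c -> pref I i a c.
Proof. by move=> ab /orP[|/eqP<- //]; apply: pref_trans. Qed.

Section Fixed.
Variable Pi : seq (subperm A).
Hypothesis gspPi : gsp I Pi.

Lemma count_arcs C x y :
  C \in Pi ->
  count (fun D => (x \in D.1) && (D.2 x == y)) Pi =
  ((x \in C.1) && (C.2 x == y)) +
  count (fun D => (x \in D.1) && (D.2 x == y)) (rem C Pi).
Proof. by move=> CP; rewrite (seq.permP (perm_to_rem CP)). Qed.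

(* A transposition uses up both of the arcs that (F4) grants to its pair. *)
Lemma transposition_notin C x :
  C \in Pi -> 2 < #|C.1| -> x \in C.1 -> transposition x (C.2 x) \notin Pi.
Proof.
move=> CP lC xC; apply/negP => TP; have Cc := gsp_cyclic gspPi CP.
have neq_xy : x != C.2 x.
  apply/eqP => xCx; have := long_cycle_arc Cc lC xC.
  by rewrite -!xCx eqxx.
have TP' : transposition x (C.2 x) \in rem C Pi.
  move: TP; rewrite (perm_mem (perm_to_rem CP)) inE => /orP[/eqP TC|//].
  by move: lC; rewrite -TC cards2; case: (_ != _).
have := gsp_F4 gspPi neq_xy; rewrite !(count_arcs _ _ CP).
rewrite !(seq.permP (perm_to_rem TP')) /= set21 set22 tpermL tpermR !eqxx xC /=.
by rewrite !add1n !addSn !addnS.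
Qed.

(** Equality in (F1) would make the successor of [x] its predecessor too, so that [C] would be a
    transposition. *)
Lemma long_cycle_pref C x :
  C \in Pi -> 2 < #|C.1| -> x \in C.1 -> pref I x (C.2 x) ((C.2)^-1%g x).
Proof.
move=> CP lC xC; have := gsp_F1 gspPi CP xC.
case/orP=> // /eqP e; have := long_cycle_arc (gsp_cyclic gspPi CP) lC xC.
by rewrite e permKV eqxx.
Qed.

(* Otherwise [z] and its predecessor in [C] form a blocking pair. *)
Lemma long_cycle_pred_worst C D z :
  C \in Pi -> D \in Pi -> 2 < #|C.1| -> z \in C.1 -> z \in D.1 ->
  ~~ pref I z ((C.2)^-1%g z) ((D.2)^-1%g z).
Proof.
move=> CP DP lC zC zD; apply/negP => p; have Cc := gsp_cyclic gspPi CP.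
set u := (C.2)^-1%g z in p; have Cu : C.2 u = z by rewrite permKV.
have uC : u \in C.1 by apply: cyclic_preim.
apply: (gsp_F2 gspPi); exists u, z; split.
- apply: contraNneq (long_cycle_arc Cc lC uC) => uz.
  by rewrite Cu -uz Cu uz.
- by rewrite -Cu transposition_notin.
- by exists C, D; split=> //; rewrite -{1}Cu long_cycle_pref.
Qed.

Lemma long_cycle_pred C D z :
  C \in Pi -> D \in Pi -> 2 < #|C.1| -> 2 < #|D.1| -> z \in C.1 -> z \in D.1 ->
  (C.2)^-1%g z = (D.2)^-1%g z.
Proof.
move=> CP DP lC lD zC zD; apply/eqP.
apply: contraT => /(pref_total I z) /orP[] p.
  by have := long_cycle_pred_worst CP DP lC zC zD; rewrite p.
by have := long_cycle_pred_worst DP CP lD zD zC; rewrite p.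
Qed.

Lemma long_cycle_sub C D z :
  C \in Pi -> D \in Pi -> 2 < #|C.1| -> 2 < #|D.1| -> z \in C.1 -> z \in D.1 ->
  C.1 \subset D.1.
Proof.
move=> CP DP lC lD zC zD.
have Cc := gsp_cyclic gspPi CP; have Dc := gsp_cyclic gspPi DP.
apply/subsetP => w; case: (Cc) => _ _ /(_ z zC) <-.
(* The orbit is walked backwards, since it is the predecessors that are known to agree. *)
rewrite -porbitV => /porbitP[i ->].
elim: i => [|i IH]; first by rewrite expg0 perm1.
have iC : ((C.2)^-1 ^+ i)%g z \in C.1.
  by elim: i {IH} => [|i IH]; rewrite ?perm1 // expgSr permM cyclic_preim.
by rewrite expgSr permM (long_cycle_pred CP DP) // cyclic_preim.
Qed.

Lemma long_cycle_unique C D z :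
  C \in Pi -> D \in Pi -> 2 < #|C.1| -> 2 < #|D.1| -> z \in C.1 -> z \in D.1 ->
  C = D.
Proof.
move=> CP DP lC lD zC zD.
have CD : C.1 = D.1.
  by apply/eqP; rewrite eqEsubset !(@long_cycle_sub _ _ z).
have [_ pC _] := gsp_cyclic gspPi CP; have [_ pD _] := gsp_cyclic gspPi DP.
rewrite [C]surjective_pairing [D]surjective_pairing CD; congr pair.
(* For the same reason, the inverses are compared. *)
apply: (can_inj invgK); apply/permP => w.
have [wC|wC] := boolP (w \in C.1).
  by apply: long_cycle_pred; rewrite -?CD.
by rewrite !(out_perm (perm_onV _) wC) // CD.
Qed.

Lemma long_cycle_notin_rem C : C \in Pi -> 2 < #|C.1| -> C \notin rem C Pi.
Proof.
move=> CP lC; have := gsp_distinct gspPi.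
rewrite (perm_uniq (perm_filter _ (perm_to_rem CP))) /= (gtn_eqF (ltnW lC)) /=.
by rewrite mem_filter (gtn_eqF (ltnW lC)) => /andP[].
Qed.

(** A cycle with such an arc is either the transposition of [x] and [C.2 x], which is not in [Pi],
    or a long cycle meeting [C]. The latter would be a second copy of [C]. *)
Lemma arc_notin_rem C D x :
  C \in Pi -> 2 < #|C.1| -> x \in C.1 -> D \in rem C Pi ->
  ~~ ((x \in D.1) && (D.2 x == C.2 x)) /\ ~~ ((C.2 x \in D.1) && (D.2 (C.2 x) == x)).
Proof.
move=> CP lC xC DR; have Cc := gsp_cyclic gspPi CP.
have DP := mem_rem DR; have Dc := gsp_cyclic gspPi DP.
have nT := transposition_notin CP lC xC.
have neq_xy : C.2 x != x.
  by apply: contraNneq (long_cycle_arc Cc lC xC) => xCx; rewrite !xCx.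
have nD z : z \in C.1 -> z \in D.1 -> 2 < #|D.1| -> False.
  move=> zC zD lD; case/negP: (long_cycle_notin_rem CP lC).
  by rewrite {1}(long_cycle_unique CP DP lC lD zC zD) DR.
split; apply/negP => /andP[zD /eqP Dz].
  apply: (nD x xC zD); apply: (arc_long_cycle Dc zD); rewrite Dz //.
  by apply: contraNneq nT => /(two_cycle Dc zD Dz) <-.
apply: (nD _ (cyclic_image Cc xC) zD); apply: (arc_long_cycle Dc zD).
  by rewrite Dz eq_sym.
apply: contraNneq nT; rewrite Dz => /(two_cycle Dc zD Dz).
by rewrite transpositionC => <-.
Qed.

Lemma gsp_paired_long C s :
  C \in Pi -> cycle_notation C s -> ~~ odd (size s) -> 2 < #|C.1| ->
  gsp I (rem C Pi ++ paired s).
Proof.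
move=> CP Cs evs lC; have Cc := gsp_cyclic gspPi CP.
have [us C1 _] := Cs; have Ts T := @mem_paired_cycle _ _ _ T Cs.
have sC x : (x \in s) = (x \in C.1) by rewrite C1 inE.
split.
- move=> D; rewrite mem_cat => /orP[/mem_rem/(gsp_cyclic gspPi) //|].
  by move=> /Ts[x _ ->]; apply: cyclic_transposition.
- rewrite filter_cat cat_uniq (filter_uniq _ (paired_uniq us evs)) andbT.
  apply/andP; split.
    have := gsp_distinct gspPi.
    rewrite (perm_uniq (perm_filter _ (perm_to_rem CP))) /=.
    by rewrite (gtn_eqF (ltnW lC)) => /andP[].
  apply/hasPn => T; rewrite mem_filter => /andP[_ /Ts[u uC ->]].
  rewrite /= mem_filter negb_and; apply/orP; right.
  by apply: contra (transposition_notin CP lC uC) => /mem_rem.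
- move=> D x; rewrite mem_cat => /orP[/mem_rem DP|/Ts[u _ ->] _].
    exact: (gsp_F1 gspPi DP).
  by rewrite /weak_pref /= tpermV eqxx orbT.
(* This turns a pair blocking the new collection into one blocking [Pi]. *)
- have worse D z : D \in rem C Pi ++ paired s -> z \in D.1 ->
      exists2 E, E \in Pi /\ z \in E.1
        & weak_pref I z ((D.2)^-1%g z) ((E.2)^-1%g z).
    rewrite mem_cat => /orP[/mem_rem DP zD|/Ts[u uC ->]] /=.
      by exists D => //; rewrite /weak_pref eqxx orbT.
    rewrite tpermV => /set2P[] ->; exists C; rewrite ?cyclic_image //.
      by rewrite tpermL; apply: (gsp_F1 gspPi CP).
    by rewrite tpermR permK /weak_pref eqxx orbT.
  case=> x [y [xy nT [D [E [[DP xD] [EP yE] p q]]]]].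
  have [D' D'P wD] := worse _ _ DP xD; have [E' E'P wE] := worse _ _ EP yE.
  apply: (gsp_F2 gspPi); exists x, y; split=> //.
    (* Only [C] has been removed, and it is too long to be a transposition. *)
    apply: contra nT; rewrite (perm_mem (perm_to_rem CP)) inE mem_cat.
    case/orP=> [/eqP TC|->//]; move: lC.
    by rewrite -TC cards2; case: (_ != _).
  by exists D', E'; split=> //; apply: weak_pref_trans; eauto.
- move=> x; rewrite -(gsp_F3 gspPi) (seq.permP (perm_to_rem CP)) count_cat /=.
  by rewrite count_paired // sC addnC.
move=> x y xy; rewrite !count_cat.
have arc_le u v :
    count (fun T => (u \in T.1) && (T.2 u == v)) (paired s) <= 1.
  apply: leq_trans (leq_b1 (u \in s)); rewrite -count_paired //.
  by apply: sub_count => T /andP[].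
(* For a new pair, the remaining cycles have no arc between [x] and [y], and the new pairs at most
   one in each direction. Otherwise the new pairs have none, and (F4) for [Pi] suffices. *)
have [Txy|nTxy] := boolP (transposition x y \in paired s).
  have rest0 (P : pred (subperm A)) :
      {in rem C Pi, forall D, ~~ P D} -> count P (rem C Pi) = 0.
    by move=> nP; apply/eqP; rewrite -leqn0 leqNgt -has_count -all_predC; apply/allP.
  have [u uC /(transposition_eq xy) uE] := Ts _ Txy.
  have nR D := @arc_notin_rem C D u CP lC uC.
  rewrite !rest0; try by move=> D /nR[n1 n2]; case: uE => -[-> ->].
  exact: (leq_add (arc_le x y) (arc_le y x)).
have paired0 a b : transposition a b = transposition x y ->
    count (fun T => (a \in T.1) && (T.2 a == b)) (paired s) = 0.
  move=> ab; apply/eqP; rewrite -leqn0 leqNgt -has_count; apply/hasPn => T TP.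
  apply: contra nTxy => /andP[aT /eqP Ta]; have [w _ TE] := Ts _ TP.
  by move: aT Ta; rewrite TE -ab => aT /(tperm_arc aT) <-; rewrite -TE.
rewrite !paired0 ?addn0 //; last exact: transpositionC.
apply: leq_trans (gsp_F4 gspPi xy).
by rewrite !(count_arcs _ _ CP) leq_add ?leq_addl.
Qed.

Lemma gsp_paired C s :
  C \in Pi -> cycle_notation C s -> ~~ odd (size s) ->
  gsp I (rem C Pi ++ paired s).
Proof.
move=> CP Cs evs; have [us C1 Cnext] := Cs; have Cc := gsp_cyclic gspPi CP.
have [lC|] := ltnP 2 #|C.1|; first exact: gsp_paired_long.
have -> : #|C.1| = size s by rewrite C1 cardsE; apply/card_uniqP.
(* Parity leaves lengths 0 and 2: the first contradicts [C.1 != set0], and in the second the only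
   pair is [C] itself. *)
case: s evs us C1 Cnext Cs => [|a [|b [|//]]] //= _.
  by case: Cc => /set0Pn[x]; move=> xC _ _ _ C1; move: xC; rewrite C1 !inE.
rewrite inE andbT => ab C1 Cnext _ _.
have -> : transposition a b = C.
  apply/esym/two_cycle; rewrite ?C1 ?inE ?eqxx // Cnext ?inE ?eqxx ?orbT //=.
  by rewrite eq_sym (negbTE ab).
by apply: gsp_perm gspPi; rewrite cats1 perm_sym perm_rcons perm_sym perm_to_rem.
Qed.

End Fixed.
End GSP.

(* [rem C Pi] removes one occurrence of C.  As
   rotr 1 [:: a_1; ...; a_k] = [:: a_k; a_1; ...; a_{k-1}], its pairing is
   (a_k a_1), (a_2 a_3), ..., (a_{k-2} a_{k-1}), and (a_k a_1) = (a_1 a_k). *)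
Theorem theorem11 (A : finType) (I : sf_instance A) (Pi : seq (subperm A))
    (C : subperm A) (s : seq A) :
  gsp I Pi -> C \in Pi -> cycle_notation C s -> ~~ odd (size s) ->
  gsp I (rem C Pi ++ paired s) /\ gsp I (rem C Pi ++ paired (rotr 1 s)).
Proof.
move=> gspPi CP Cs evs; split; first exact: gsp_paired.
by apply: gsp_paired; rewrite ?size_rotr //; apply: cycle_notation_rotr.
Qed.
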